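(* Let $d\in\mathbb{Z}_+$. A function $f:\mathbb{Z}_+^d\to\mathbb{R}$ is positive definite if and only if the matrix $(\{1,\ldots,m\}^d)_f$ is positive semidefinite for all $m\in\mathbb{Z}_+$.
   Context: $\mathbb{Z}_+$ is the set of positive integers. For $\boldsymbol{x}=(x_1,\ldots,x_d)$ and $\boldsymbol{y}=(y_1,\ldots,y_d)$ in $\mathbb{Z}_+^d$ put $(\boldsymbol{x},\boldsymbol{y})_d=(\gcd(x_1,y_1),\ldots,\gcd(x_d,y_d))\in\mathbb{Z}_+^d$. For a finite nonempty set $S\subset\mathbb{Z}_+^d$ and $f:\mathbb{Z}_+^d\to\mathbb{R}$, let $(S)_f$ denote the matrix $(f((\boldsymbol{x},\boldsymbol{y})_d))_{\boldsymbol{x}\in S,\boldsymbol{y}\in S}$. The function $f$ is called positive definite if $(S)_f$ is positive semidefinite for every finite nonempty $S\subset\mathbb{Z}_+^d$. *)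

(* Defs.v *)
From HB Require Import structures.
From mathcomp Require Import all_boot all_order all_algebra.
From mathcomp Require Import finmap reals.

Set Implicit Arguments.
Unset Strict Implicit.
Unset Printing Implicit Defensive.

Import Order.TTheory GRing.Theory Num.Theory.

Local Open Scope ring_scope.

Notation posnat := {n : nat | (0 < n)%N}.

Lemma gcdn_pos (a b : posnat) : (0 < gcdn (val a) (val b))%N.
Proof. by rewrite gcdn_gt0 (valP a). Qed.

Definition gcdp (a b : posnat) : posnat :=
  exist _ (gcdn (val a) (val b)) (gcdn_pos a b).

Notation posvec d := {ffun 'I_d -> posnat}.

Definition gcdvec (d : nat) (x y : posvec d) : posvec d :=
  [ffun i => gcdp (x i) (y i)].

(* Rows and columns are numbered by the fixed enumeration of S given by
   enum_val; another enumeration only permutes rows and columns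
   simultaneously. *)
Definition gcd_mx (R : realType) (d : nat) (S : {fset (posvec d)})
    (f : posvec d -> R) : 'M[R]_#|{: S}| :=
  \matrix_(i, j) f (gcdvec (val (enum_val i)) (val (enum_val j))).

Definition psd_mx (R : realType) (n : nat) (A : 'M[R]_n) : Prop :=
  A^T = A /\ forall v : 'cV[R]_n, 0 <= (v^T *m A *m v) 0 0.

Definition positive_definite (R : realType) (d : nat)
    (f : posvec d -> R) : Prop :=
  forall S : {fset (posvec d)}, S != fset0 -> psd_mx (gcd_mx S f).

Definition posS (k : nat) : posnat := exist _ k.+1 (ltn0Sn k).

Definition shiftvec (d m : nat) (k : {ffun 'I_d -> 'I_m}) : posvec d :=
  [ffun i => posS (k i)].

Definition box (d m : nat) : {fset (posvec d)} :=
  [fset shiftvec k | k : {ffun 'I_d -> 'I_m}]%fset.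

Lemma mem_box (d m : nat) (x : posvec d) :
  (x \in box d m) = [forall i, (val (x i) <= m)%N].
Proof.
apply/imfsetP/forallP => [[k _ ->] i|le_xm]; first by rewrite ffunE /= ltn_ord.
have lt_xm i : ((val (x i)).-1 < m)%N by rewrite prednK ?(valP (x i)) ?le_xm.
exists [ffun i => Ordinal (lt_xm i)] => //; apply/ffunP => i.
by apply: val_inj; rewrite !ffunE /= prednK ?(valP (x i)).
Qed.

(* Main.v *)
Require Import Defs.
From mathcomp Require Import all_boot all_order all_algebra.
From mathcomp Require Import finmap reals.

(** Every finite [S] lies in some box, so its gcd matrix is a principal
    submatrix of the gcd matrix of that box: extend test vectors by zero. *)

Set Implicit Arguments.
Unset Strict Implicit.
Unset Printing Implicit Defensive.

Import Order.TTheory GRing.Theory Num.Theory.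

Local Open Scope ring_scope.
Local Open Scope fset_scope.

Section GcdMatrix.

Variables (R : realType) (d : nat).
Implicit Types (S T : {fset (posvec d)}) (f w : posvec d -> R).

(** One direction is specialization, since a box with [0 < m] is nonempty ([box_neq0]). Conversely,
    a finite set has bounded coordinates and so fits in a box ([fset_sub_box]), and positive
    semidefiniteness passes from the box to its subset ([psd_gcd_mxS]). *)

Lemma gcdvecC (x y : posvec d) : gcdvec x y = gcdvec y x.
Proof. by apply/ffunP => i; rewrite !ffunE; apply: val_inj; rewrite /= gcdnC. Qed.

Lemma gcd_mx_sym S f : (gcd_mx S f)^T = gcd_mx S f.
Proof. by apply/matrixP => i j; rewrite !mxE gcdvecC. Qed.

Lemma sum_enum_fset S (F : posvec d -> R) :
  \sum_(i < #|{: S}|) F (val (enum_val i)) = \sum_(x <- S) F x.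
Proof.
rewrite big_seq_fsetE /= [RHS](reindex (@enum_val S {: S})) //=.
exact/onW_bij/enum_val_bij.
Qed.

(** With [w] defined on all vectors, the quadratic form no longer depends on the enumeration of [S].
    Forms over different sets, whose matrices differ in size, can then be compared. *)
Lemma gcd_mx_form S f w (v := \col_i w (val (enum_val i)) : 'cV_#|{: S}|) :
  (v^T *m gcd_mx S f *m v) 0 0 =
  \sum_(y <- S) \sum_(x <- S) w x * f (gcdvec x y) * w y.
Proof.
rewrite mxE -sum_enum_fset; apply: eq_bigr => j _.
rewrite -sum_enum_fset !mxE mulr_suml; apply: eq_bigr => i _.
by rewrite !mxE.
Qed.

Lemma psd_gcd_mxS S T f :
  S `<=` T -> psd_mx (gcd_mx T f) -> psd_mx (gcd_mx S f).
Proof.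
move=> sST [_ psdT]; split=> [|v]; first exact: gcd_mx_sym.
(* [w] is [v] read as a function on [S] and extended by zero. *)
pose w x := if insub x is Some u then v (enum_rank (u : S)) 0 else 0.
have wS x : x \notin S -> w x = 0 by rewrite /w; case: insubP => // ? ->.
have -> : v = \col_i w (val (enum_val i)).
  by apply/colP => i; rewrite mxE /w valK enum_valK.
(* Terms with [x] or [y] outside [S] vanish, so first the outer and then the inner sum can be
   enlarged from [S] to [T]. *)
rewrite gcd_mx_form (big_fset_incl _ sST) => [|y _ /wS wy0]; last first.
  by rewrite big1 // => x _; rewrite wy0 mulr0.
under eq_bigr => y _.
  rewrite (big_fset_incl _ sST) => [|x _ /wS wx0]; last by rewrite wx0 !mul0r.
  over.
by rewrite -gcd_mx_form.
Qed.

Lemma fset_sub_box S : exists2 m : nat, (0 < m)%N & S `<=` box d m.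
Proof.
(* The largest coordinate already bounds [S]; the successor makes [m] positive even when [S] is
   empty. *)
exists (\max_(x <- S) \max_(i < d) val (x i))%N.+1 => //.
apply/fsubsetP => x xS; rewrite mem_box; apply/forallP => i; apply: leqW.
pose M (y : posvec d) := (\max_(j < d) val (y j))%N.
have le_xM : (val (x i) <= M x)%N by exact: (leq_bigmax (F := fun j => val (x j))).
exact: leq_trans le_xM (leq_bigmax_seq (F := M) x xS isT).
Qed.

Lemma box_neq0 m : (0 < m)%N -> box d m != fset0.
Proof.
move=> m_gt0; apply/fset0Pn; exists [ffun=> posS 0].
by rewrite mem_box; apply/forallP => i; rewrite ffunE.
Qed.

End GcdMatrix.

Theorem theorem4p2 (R : realType) (d : nat) (hd : (0 < d)%N)
    (f : posvec d -> R) :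
  positive_definite f <->
  (forall m : nat, (0 < m)%N -> psd_mx (gcd_mx (box d m) f)).
Proof.
split=> [pd m /(box_neq0 d)|psd_box S _]; first exact: pd.
have [m m_gt0 sSm] := fset_sub_box S.
exact: psd_gcd_mxS sSm (psd_box m m_gt0).
Qed.
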